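(* Let $n\ge 1$. The join-irreducible elements of the Dyck lattice $\mathcal{D}_n$ are exactly the Dyck paths of length $2n$ with exactly one pyramid, that is, the paths of the form $$(UD)^{i}\,U^{j-i}D^{j-i}\,(UD)^{n-j},\qquad 0\le i\le j-2,\ j\le n.$$ In particular, the spectrum of $\mathcal{D}_n$ (the poset of its join-irreducible elements) is isomorphic to the poset of the intervals of a chain with $n-1$ elements: $$\mathbf{Spec}(\mathcal{D}_n)\simeq\{(i,j)\in\mathcal{C}_n^2 : i\le j-2\}\simeq\mathbf{Int}(\mathcal{C}_{n-2}).$$
   Context: The Dyck lattice $\mathcal{D}_n$ is the set of Dyck paths of length $2n$, i.e. functions $f:\{0,\ldots,2n\}\to\mathbb{N}$ with $f(0)=f(2n)=0$ and $f(k+1)-f(k)\in\{1,-1\}$, ordered by $f\le g$ iff $f(k)\le g(k)$ for all $k$. It is a finite distributive lattice with minimum $\widehat 0=(UD)^n$. Paths are also written as words in $U$ (up step $(1,1)$) and $D$ (down step $(1,-1)$). A pyramid of a Dyck path is a maximal sequence of consecutive steps of the form $U^hD^h$, $h\ge1$, such that replacing it by $U^{h-1}DUD^{h-1}$ yields again a Dyck path. A join-irreducible element of a distributive lattice is an element $x\ne\widehat0$ such that $x=u\vee v$ implies $x=u$ or $x=v$. $\mathbf{Spec}$ denotes the set of join-irreducibles with the induced order. $\mathcal{C}_m$ is the chain $\{0<1<\cdots<m\}$ with $m+1$ elements ($\mathcal{C}_{-1}=\emptyset$), and $\mathbf{Int}(\mathcal{C}_m)$ is the set of its nonempty intervals ordered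 by inclusion. The pairs $(i,j)$ are thought of as intervals $[i,j]$ and ordered by inclusion: $(i,j)\le(i',j')$ iff $i'\le i$ and $j\le j'$. *)

(* Defs.v *)
From HB Require Import structures.
From mathcomp Require Import all_boot all_order zify.

Set Implicit Arguments.
Unset Strict Implicit.
Unset Printing Implicit Defensive.

Import Order.TTheory.

Section OrderNotions.
Local Open Scope order_scope.

Definition order_isomorphic d d' (P : porderType d) (Q : porderType d') : Prop :=
  exists f : P -> Q, bijective f /\ {mono f : x y / x <= y}.

Definition join_irreducible d (L : finTBDistrLatticeType d) (x : L) : bool :=
  (x != \bot) &&
  [forall u : L, forall v : L, (x == u `|` v) ==> ((x == u) || (x == v))].

Record spec d (L : finTBDistrLatticeType d) : Type :=
  Spec { spec_val : L; _ : join_irreducible spec_val }.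

Definition is_nonempty_interval d (P : finPOrderType d) (A : {set P}) : bool :=
  (A != set0) && [exists a : P, exists b : P, A == [set x | (a <= x) && (x <= b)]].

Record intervals d (P : finPOrderType d) : Type :=
  Interval { interval_set :> {set P}; _ : is_nonempty_interval interval_set }.

End OrderNotions.

HB.instance Definition _ d (L : finTBDistrLatticeType d) :=
  [isSub for @spec_val d L].
HB.instance Definition _ d (L : finTBDistrLatticeType d) :=
  [Finite of spec L by <:].
HB.instance Definition _ d (L : finTBDistrLatticeType d) :=
  [SubChoice_isSubPOrder of spec L by <: with d].

HB.instance Definition _ d (P : finPOrderType d) :=
  [isSub for @interval_set d P].
HB.instance Definition _ d (P : finPOrderType d) :=
  [Finite of intervals P by <:].

Fact interval_display : Order.disp_t. Proof. exact: Order.Disp tt tt. Qed.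

Section IntervalOrder.
Variables (d : Order.disp_t) (P : finPOrderType d).

Definition interval_le (A B : intervals P) : bool := A \subset B.

Fact interval_le_refl : reflexive interval_le.
Proof. by move=> A; apply: subxx. Qed.
Fact interval_le_anti : antisymmetric interval_le.
Proof. by move=> A B AB; apply/val_inj/eqP; rewrite eqEsubset. Qed.
Fact interval_le_trans : transitive interval_le.
Proof. by move=> B A C; apply: subset_trans. Qed.

HB.instance Definition _ :=
  Order.Le_isPOrder.Build interval_display (intervals P)
    interval_le_refl interval_le_anti interval_le_trans.

End IntervalOrder.

(* The chain C_m = {0 < 1 < ... < m} is ['I_m.+1]; in particular C_(-1) is
   ['I_0] and, for n >= 1, C_(n-2) is ['I_n.-1]. *)

Fact far_display : Order.disp_t. Proof. exact: Order.Disp tt tt. Qed.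

Section FarPairs.
Variable n : nat.

(* The condition i <= j - 2, without truncated subtraction. *)
Record far_pairs : Type := FarPair {
  far_val :> 'I_n.+1 * 'I_n.+1;
  _ : far_val.1 + 2 <= far_val.2
}.

HB.instance Definition _ := [isSub for far_val].
HB.instance Definition _ := [Finite of far_pairs by <:].

Definition far_le (p q : far_pairs) : bool :=
  ((val q).1 <= (val p).1) && ((val p).2 <= (val q).2).

Fact far_le_refl : reflexive far_le.
Proof. by move=> p; rewrite /far_le !leqnn. Qed.
Fact far_le_anti : antisymmetric far_le.
Proof.
move=> p q /andP[/andP[h1 h2] /andP[h3 h4]]; apply: val_inj.
rewrite [val p]surjective_pairing [val q]surjective_pairing.
by congr pair; apply/val_inj/eqP; rewrite eqn_leq ?h1 ?h2 ?h3 ?h4.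
Qed.
Fact far_le_trans : transitive far_le.
Proof.
move=> q p r /andP[h1 h2] /andP[h3 h4].
by rewrite /far_le (leq_trans h3 h1) (leq_trans h2 h4).
Qed.

HB.instance Definition _ :=
  Order.Le_isPOrder.Build far_display far_pairs
    far_le_refl far_le_anti far_le_trans.

End FarPairs.

Fact dyck_display : Order.disp_t. Proof. exact: Order.Disp tt tt. Qed.

Section DyckPaths.
Variable n : nat.

Definition is_dyck (f : {ffun 'I_(n.*2).+1 -> nat}) : bool :=
  [&& f ord0 == 0, f ord_max == 0 &
    [forall k : 'I_(n.*2),
      (f (inord k.+1) == (f (inord k)).+1) ||
      (f (inord k) == (f (inord k.+1)).+1)]].

Record dyck : Type :=
  Dyck { dyck_fun :> {ffun 'I_(n.*2).+1 -> nat}; _ : is_dyck dyck_fun }.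

HB.instance Definition _ := [isSub for dyck_fun].
HB.instance Definition _ := [Choice of dyck by <:].

Lemma dyck_inj (x y : dyck) : (forall k, x k = y k) -> x = y.
Proof. by move=> e; apply/val_inj/ffunP. Qed.

Lemma dyckP (f : {ffun 'I_(n.*2).+1 -> nat}) :
  reflect [/\ f (inord 0) = 0, f (inord n.*2) = 0 &
    forall k, k < n.*2 ->
      f (inord k.+1) = (f (inord k)).+1 \/ f (inord k) = (f (inord k.+1)).+1]
    (is_dyck f).
Proof.
have e0 : inord 0 = ord0 :> 'I_(n.*2).+1.
  by apply/val_inj; rewrite /= inordK.
have e1 : inord n.*2 = ord_max :> 'I_(n.*2).+1.
  by apply/val_inj; rewrite /= inordK.
rewrite /is_dyck e0 e1; apply: (iffP and3P) => -[/eqP h0 /eqP h1 h].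
  split=> // k lk; have /orP[/eqP ->|/eqP <-] := forallP h (Ordinal lk).
    by left.
  by right.
split=> //.
by apply/forallP=> k; case: (h k (ltn_ord k)) => ->; rewrite eqxx ?orbT.
Qed.

Lemma dyck_bounds (x : dyck) k : k <= n.*2 ->
  x (inord k) <= k /\ odd (x (inord k)) = odd k.
Proof.
have [h0 _ h] := dyckP _ (valP x).
elim: k => [|k IH] lk; first by rewrite h0.
by case: (IH (ltnW lk)) => IHl IHo; case: (h k lk) => /= e; move: e IHl IHo; lia.
Qed.

Lemma dyck_bounds_end (x : dyck) k : k <= n.*2 -> x (inord k) <= n.*2 - k.
Proof.
have [_ h1 h] := dyckP _ (valP x).
move=> lk; rewrite -{1}(subKn lk); move: (n.*2 - k) (leq_subr k n.*2).
elim=> [|m IH] lm; first by rewrite subn0 h1.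
have := IH (ltnW lm); have lt : n.*2 - m.+1 < n.*2 by lia.
have -> : n.*2 - m = (n.*2 - m.+1).+1 by lia.
by case: (h _ lt) => /= e; lia.
Qed.

Lemma dyck_odd (x : dyck) (k : 'I_(n.*2).+1) : odd (x k) = odd k.
Proof.
by have [_] := dyck_bounds x (leq_ord k); rewrite inord_val.
Qed.

Lemma dyck_le (x : dyck) (k : 'I_(n.*2).+1) : x k <= minn k (n.*2 - k).
Proof.
have [le _] := dyck_bounds x (leq_ord k).
have := dyck_bounds_end x (leq_ord k).
by rewrite inord_val in le *; rewrite leq_min le.
Qed.

(* Heights are at most 2n, whence the finiteness of [dyck]. *)
Definition dyck_code (x : dyck) : {ffun 'I_(n.*2).+1 -> 'I_(n.*2).+1} :=
  [ffun k => inord (x k)].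

Definition dyck_decode (f : {ffun 'I_(n.*2).+1 -> 'I_(n.*2).+1}) : option dyck :=
  insub [ffun k => f k : nat].

Lemma dyck_codeK : pcancel dyck_code dyck_decode.
Proof.
move=> x; rewrite /dyck_decode /dyck_code.
rewrite (_ : finfun _ = val x) ?valK //.
apply/ffunP=> k; rewrite !ffunE inordK // ltnS.
by have := dyck_le x k; have := leq_ord k; lia.
Qed.

HB.instance Definition _ : isCountable dyck := PCanIsCountable dyck_codeK.
HB.instance Definition _ : isFinite dyck := PCanIsFinite dyck_codeK.

Definition dyck_leq (x y : dyck) : bool := [forall k, x k <= y k].

Lemma dyck_meet_subproof (x y : dyck) : is_dyck [ffun k => minn (x k) (y k)].
Proof.
have [hx0 hx1 hx] := dyckP _ (valP x); have [hy0 hy1 hy] := dyckP _ (valP y).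
move: hx0 hx1 hy0 hy1 => /= hx0 hx1 hy0 hy1.
apply/dyckP; split=> [||k lk]; rewrite !ffunE ?hx0 ?hx1 ?hy0 ?hy1 //.
have [_ ox] := dyck_bounds x (ltnW lk); have [_ oy] := dyck_bounds y (ltnW lk).
by move: ox oy (hx k lk) (hy k lk) => /=; lia.
Qed.

Lemma dyck_join_subproof (x y : dyck) : is_dyck [ffun k => maxn (x k) (y k)].
Proof.
have [hx0 hx1 hx] := dyckP _ (valP x); have [hy0 hy1 hy] := dyckP _ (valP y).
move: hx0 hx1 hy0 hy1 => /= hx0 hx1 hy0 hy1.
apply/dyckP; split=> [||k lk]; rewrite !ffunE ?hx0 ?hx1 ?hy0 ?hy1 //.
have [_ ox] := dyck_bounds x (ltnW lk); have [_ oy] := dyck_bounds y (ltnW lk).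
by move: ox oy (hx k lk) (hy k lk) => /=; lia.
Qed.

Definition dyck_meet (x y : dyck) : dyck := Dyck (dyck_meet_subproof x y).
Definition dyck_join (x y : dyck) : dyck := Dyck (dyck_join_subproof x y).

Lemma dyck_leq_def x y : dyck_leq x y = (dyck_meet x y == x).
Proof.
apply/forallP/eqP => [h|<- k]; last by rewrite /= ffunE geq_minr.
by apply: dyck_inj => k; rewrite /= ffunE; apply/minn_idPl/h.
Qed.

Fact dyck_meetC : commutative dyck_meet.
Proof. by move=> x y; apply: dyck_inj => k; rewrite /= !ffunE minnC. Qed.
Fact dyck_joinC : commutative dyck_join.
Proof. by move=> x y; apply: dyck_inj => k; rewrite /= !ffunE maxnC. Qed.
Fact dyck_meetA : associative dyck_meet.
Proof. by move=> x y z; apply: dyck_inj => k; rewrite /= !ffunE minnA. Qed.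
Fact dyck_joinA : associative dyck_join.
Proof. by move=> x y z; apply: dyck_inj => k; rewrite /= !ffunE maxnA. Qed.
Fact dyck_joinKI y x : dyck_meet x (dyck_join x y) = x.
Proof. by apply: dyck_inj => k; rewrite /= !ffunE; lia. Qed.
Fact dyck_meetKU y x : dyck_join x (dyck_meet x y) = x.
Proof. by apply: dyck_inj => k; rewrite /= !ffunE; lia. Qed.
Fact dyck_meetUl : left_distributive dyck_meet dyck_join.
Proof. by move=> x y z; apply: dyck_inj => k; rewrite /= !ffunE minn_maxl. Qed.
Fact dyck_meetxx : idempotent_op dyck_meet.
Proof. by move=> x; apply: dyck_inj => k; rewrite /= !ffunE minnn. Qed.

HB.instance Definition _ :=
  Order.isMeetJoinDistrLattice.Build dyck_display dyck
    dyck_leq_def (fun _ _ => erefl) dyck_meetC dyck_joinC dyck_meetA dyck_joinA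
    dyck_joinKI dyck_meetKU dyck_meetUl dyck_meetxx.

Lemma dyck_bot_subproof : is_dyck [ffun k : 'I_(n.*2).+1 => odd k : nat].
Proof.
apply/dyckP; split=> [||k lk]; rewrite !ffunE !inordK ?odd_double //; last by lia.
by rewrite /=; case: (odd k); [right|left].
Qed.

Lemma dyck_top_subproof :
  is_dyck [ffun k : 'I_(n.*2).+1 => minn k (n.*2 - k)].
Proof.
by apply/dyckP; split=> [||k lk]; rewrite !ffunE !inordK //; lia.
Qed.

(* (UD)^n *)
Definition dyck_bot : dyck := Dyck dyck_bot_subproof.
(* U^n D^n *)
Definition dyck_top : dyck := Dyck dyck_top_subproof.

Fact dyck_bot_le (x : dyck) : (dyck_bot <= x)%O.
Proof.
apply/forallP=> k; rewrite /= ffunE -(dyck_odd x k).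
by case: (x k) => // m; case: odd.
Qed.

Fact dyck_le_top (x : dyck) : (x <= dyck_top)%O.
Proof. by apply/forallP=> k; rewrite /= ffunE dyck_le. Qed.

HB.instance Definition _ := Order.hasBottom.Build dyck_display dyck dyck_bot_le.
HB.instance Definition _ := Order.hasTop.Build dyck_display dyck dyck_le_top.

End DyckPaths.

Definition U : bool := true.
Definition D : bool := false.

Definition word n (x : dyck n) : seq bool :=
  mkseq (fun k => if x (inord k) < x (inord k.+1) then U else D) n.*2.

Definition UD_pow (i : nat) : seq bool := flatten (nseq i [:: U; D]).

Section Pyramids.
Variables (n : nat) (x : dyck n).

(* [x] has a factor U^h D^h starting at its step number [p] (from 0), whose
   replacement by U^(h-1) D U D^(h-1) yields a Dyck path. *)
Definition replaceable (p h : nat) : Prop :=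
  0 < h /\
  exists s t : seq bool,
    [/\ size s = p,
        word x = s ++ nseq h U ++ nseq h D ++ t &
        exists y : dyck n,
          word y = s ++ nseq h.-1 U ++ [:: D; U] ++ nseq h.-1 D ++ t].

Definition pyramid (p h : nat) : Prop :=
  replaceable p h /\
  forall p' h', replaceable p' h' ->
    p' <= p -> p + h.*2 <= p' + h'.*2 -> p' = p /\ h' = h.

Definition has_exactly_one_pyramid : Prop :=
  exists! s : nat * nat, pyramid s.1 s.2.

End Pyramids.

(* Main.v *)
(* A pyramid is determined by its centre, and the centres are exactly the peaks
   of height at least 2.  Lowering any one of these peaks by 2 gives a smaller
   Dyck path, so a path with two of them is the join of the two lowered paths,
   while a path with none is (UD)^n: join-irreducibles have exactly one.  A path
   descending (ascending) from a height at least 2 has such a peak to the left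
   (right), so a path with a unique one is squeezed onto the "tent"
   (UD)^i U^(j-i) D^(j-i) (UD)^(n-j).  A tent is join-irreducible because a path
   lies above it as soon as it reaches its apex; this also gives the order on
   tents, which is that of the pairs (i, j).  Finally (i, j) is
   sent to the interval [i, j - 2] of the chain. *)

Require Import Defs.
From mathcomp Require Import all_boot all_order zify.

Set Implicit Arguments.
Unset Strict Implicit.
Unset Printing Implicit Defensive.

Import Order.TTheory.

(** * Heights of Dyck paths and their link to words *)

Section Height.
Variable n : nat.
Implicit Types x y : dyck n.

(** Natural-number abscissas make step arithmetic free of ordinals. Beyond [n.*2], [inord] falls
    back to index 0, hence the bounds on [k] below. *)
Definition ht x (k : nat) : nat := x (inord k).

Lemma ht0 x : ht x 0 = 0.
Proof. by have [] := dyckP _ (valP x). Qed.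

Lemma ht_end x : ht x n.*2 = 0.
Proof. by have [] := dyckP _ (valP x). Qed.

Lemma ht_step x k : k < n.*2 ->
  ht x k.+1 = (ht x k).+1 \/ ht x k = (ht x k.+1).+1.
Proof. by have [_ _ h] := dyckP _ (valP x); apply: h. Qed.

Lemma ht_odd x k : k <= n.*2 -> odd (ht x k) = odd k.
Proof. by move=> lk; have [] := dyck_bounds x lk. Qed.

Lemma ht_Dyck (f : nat -> nat) (fP : is_dyck [ffun k : 'I_(n.*2).+1 => f k]) k :
  k <= n.*2 -> ht (Dyck fP) k = f k.
Proof. by move=> lk; rewrite /ht /= ffunE inordK. Qed.

Lemma ht_inj x y : (forall k, k <= n.*2 -> ht x k = ht y k) -> x = y.
Proof.
by move=> e; apply: dyck_inj => k; have := e k (leq_ord k); rewrite /ht inord_val.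
Qed.

Lemma le_htP x y :
  reflect (forall k, k <= n.*2 -> ht x k <= ht y k) (x <= y)%O.
Proof.
apply: (iffP forallP) => [h k _|h k]; first exact: h.
by have := h k (leq_ord k); rewrite /ht inord_val.
Qed.

Lemma ht_join x y k : ht (x `|` y)%O k = maxn (ht x k) (ht y k).
Proof. by rewrite /ht /= ffunE. Qed.

Lemma ht_bot k : k <= n.*2 -> ht (\bot : dyck n)%O k = odd k.
Proof. by move=> lk; rewrite /ht /= ffunE inordK. Qed.

Lemma ht_lipschitz x a b : a <= b -> b <= n.*2 ->
  ht x a <= ht x b + (b - a) /\ ht x b <= ht x a + (b - a).
Proof.
elim: b => [|b IH] lab lb; first by (have -> : a = 0 by lia); lia.
have [->|ne] := eqVneq a b.+1; first by lia.
by have := IH ltac:(lia) ltac:(lia); case: (ht_step x lb); lia.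
Qed.

Lemma size_word x : size (word x) = n.*2.
Proof. exact: size_mkseq. Qed.

(** With u up steps among the first k, the height is u - (k - u). This form avoids subtraction and
    turns questions about words into questions about heights. *)
Lemma count_take_word x k : k <= n.*2 ->
  (count id (take k (word x))).*2 = ht x k + k.
Proof.
elim: k => [|k IH] lk; first by rewrite take0 ht0.
rewrite (take_nth D) ?size_word // -cats1 count_cat doubleD IH; last by lia.
rewrite /word nth_mkseq // -!/(ht x _) /U /D.
by case: (ht_step x lk) => e; case: ifP => /=; lia.
Qed.

Lemma eq_from_count_take (v w : seq bool) : size v = size w ->
  (forall k, k <= size v -> count id (take k v) = count id (take k w)) -> v = w.
Proof.
move=> sz h; apply: (eq_from_nth (x0 := D)) => // k lk.
have := h k.+1 lk; rewrite !(take_nth D) -?sz // -!cats1 !count_cat h; last by lia.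
by move/addnI => /=; rewrite !addn0; case: nth; case: nth.
Qed.

Lemma word_eq x w : size w = n.*2 ->
  (forall k, k <= n.*2 -> (count id (take k w)).*2 = ht x k + k) -> word x = w.
Proof.
move=> sz h; apply: eq_from_count_take => [|k]; first by rewrite size_word.
by rewrite size_word => lk; apply: double_inj; rewrite count_take_word // h.
Qed.

Lemma word_inj : injective (@word n).
Proof.
move=> x y e; apply: ht_inj => k lk; apply/eqP.
by rewrite -(eqn_add2r k) -!count_take_word // e.
Qed.

End Height.

(** * Counting up steps in prefixes of explicit words *)

Lemma count_take_cat k (v w : seq bool) :
  count id (take k (v ++ w)) = count id (take k v) + count id (take (k - size v) w).
Proof.
rewrite take_cat; case: ltnP => lk.
  by rewrite (_ : k - size v = 0) ?take0 ?addn0 //; lia.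
by rewrite count_cat (take_oversize lk).
Qed.

Lemma count_take_U k m : count id (take k (nseq m U)) = minn k m.
Proof. by elim: m k => [|m IH] [|k] //=; rewrite IH minnSS. Qed.

Lemma count_take_D k m : count id (take k (nseq m D)) = 0.
Proof. by elim: m k => [|m IH] [|k] //=; rewrite IH. Qed.

Lemma size_UD_pow i : size (UD_pow i) = i.*2.
Proof. by elim: i => //= i ->. Qed.

Lemma count_take_UD_pow k i : count id (take k (UD_pow i)) = minn (uphalf k) i.
Proof. by elim: i k => [|i IH] [|[|k]] //=; rewrite ?IH; lia. Qed.

(** * The paths with a single pyramid, described by heights *)

Section Tent.
Variable n : nat.
Implicit Types x y : dyck n.

(** The maximum of the zigzag of (UD)^n and a triangle with feet 2i, 2j and apex of height j - i at
    i + j. Truncated subtraction flattens the triangle outside its feet. *)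
Definition tent_ht (i j k : nat) : nat :=
  maxn (odd k) (minn (k - i.*2) (j.*2 - k)).

Lemma tent_ht_out i j k : (k <= i.*2) || (j.*2 <= k) -> tent_ht i j k = odd k.
Proof. by rewrite /tent_ht -!subn_eq0 => /orP[]/eqP->; rewrite ?minn0 ?min0n maxn0. Qed.

Lemma tent_ht_in i j k : i.*2 <= k <= j.*2 ->
  tent_ht i j k = minn (k - i.*2) (j.*2 - k).
Proof.
move=> /andP[l1 l2]; apply/maxn_idPr.
(* An odd abscissa differs from both feet, so the triangle has height at least 1 there. *)
have [ok|//] := boolP (odd k).
have ne a : a.*2 != k by apply: contraTneq ok => <-; rewrite odd_double.
by rewrite leq_min !subn_gt0 !ltn_neqAle l1 l2 ne eq_sym ne.
Qed.

Lemma tent_ht_up i j k : i.*2 <= k -> k <= i + j -> tent_ht i j k = k - i.*2.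
Proof.
move=> l1 l2; rewrite tent_ht_in; last by clear -l1 l2; lia.
by apply/minn_idPl; clear -l1 l2; lia.
Qed.

Lemma tent_ht_down i j k : i + j <= k -> k <= j.*2 -> tent_ht i j k = j.*2 - k.
Proof.
move=> l1 l2; rewrite tent_ht_in; last by clear -l1 l2; lia.
by apply/minn_idPr; clear -l1 l2; lia.
Qed.

Lemma tent_ht_step i j k : tent_ht i j k.+1 = (tent_ht i j k).+1 \/
  tent_ht i j k = (tent_ht i j k.+1).+1.
Proof.
case: (boolP ((k < i.*2) || (j.*2 <= k))) => [out|].
  rewrite !tent_ht_out; [|clear -out; lia..].
  by rewrite /=; case: odd; [right | left].
rewrite negb_or -leqNgt -ltnNge => /andP[l1 l2].
case: (ltnP k (i + j)) => lk.
  by left; rewrite !tent_ht_up; clear -l1 lk; lia.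
by right; rewrite !tent_ht_down; clear -l2 lk; lia.
Qed.

Lemma tent_subproof i j : is_dyck [ffun k : 'I_(n.*2).+1 => tent_ht i (minn j n) k].
Proof.
apply/dyckP; split=> [||k lk]; rewrite !ffunE !inordK //.
- by rewrite tent_ht_out ?leq0n.
- by rewrite tent_ht_out ?odd_double // (leq_double (minn j n)) geq_minr orbT.
- exact: tent_ht_step.
- exact: ltnW.
Qed.

(* The path (UD)^i U^(j-i) D^(j-i) (UD)^(n-j); the truncation of [j] at [n] only
   serves to make this a total function. *)
Definition tent i j : dyck n := Dyck (tent_subproof i j).

Lemma ht_tent i j k : j <= n -> k <= n.*2 -> ht (tent i j) k = tent_ht i j k.
Proof. by move=> /minn_idPl ljn lk; rewrite ht_Dyck // ljn. Qed.

Lemma word_tent i j : i <= j -> j <= n ->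
  word (tent i j) = UD_pow i ++ nseq (j - i) U ++ nseq (j - i) D ++ UD_pow (n - j).
Proof.
move=> lij ljn; apply: word_eq => [|k lk].
  by rewrite !size_cat !size_UD_pow !size_nseq; clear -lij ljn; lia.
rewrite !count_take_cat !count_take_UD_pow count_take_U count_take_D add0n.
rewrite !size_UD_pow !size_nseq ht_tent //.
have -> : k - i.*2 - (j - i) - (j - i) = k - j.*2 by clear -lij; lia.
case: (leqP k i.*2) => lki.
  rewrite tent_ht_out ?lki // (minn_idPl _) ?leq_uphalf_double //.
  have lkj : k <= j.*2 by rewrite (leq_trans lki) ?leq_double.
  by move: lki lkj; rewrite -!subn_eq0 => /eqP-> /eqP->; rewrite !min0n !addn0 uphalfK.
(* Past 2i the prefix contains all i up steps of the first factor. *)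
rewrite (minn_idPr (_ : i <= uphalf k)); last first.
  by rewrite -leq_double uphalfK (leq_trans (ltnW lki)) ?leq_addl.
case: (leqP k j.*2) => lkj.
  have -> : k - j.*2 = 0 by apply/eqP.
  rewrite min0n addn0; case: (leqP k (i + j)) => lkm.
    rewrite tent_ht_up ?(ltnW lki) // (minn_idPl _); clear -lki lkm; lia.
  rewrite tent_ht_down ?(ltnW lkm) // (minn_idPr _); clear -lki lkm lkj lij; lia.
rewrite tent_ht_out ?(ltnW lkj) ?orbT // (minn_idPr (_ : j - i <= k - i.*2)).
  rewrite (minn_idPl _); last by rewrite leq_uphalf_double; clear -lk ljn; lia.
  by rewrite !doubleD uphalfK oddB ?(ltnW lkj) // odd_double addbF; clear -lij lkj; lia.
by clear -lij lkj; lia.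
Qed.

(* Heights are 1-Lipschitz and have the parity of their abscissa, and the tent is
   the least such function through its apex. *)
Lemma tent_le i j x : i <= j -> j <= n ->
  (tent i j <= x)%O = (j - i <= ht x (i + j)).
Proof.
move=> lij ljn; have lm : i + j <= n.*2 by clear -lij ljn; lia.
apply/le_htP/idP => [h|h k lk].
  apply: leq_trans (h _ lm); rewrite ht_tent // tent_ht_up //; clear -lij; lia.
rewrite ht_tent //.
have odd_le : odd k <= ht x k.
  by rewrite -(ht_odd x lk); case: (ht x k) => // m; apply: leq_trans (leq_b1 _) _.
case: (leqP k i.*2) => lki; first by rewrite tent_ht_out ?lki.
case: (leqP j.*2 k) => ljk; first by rewrite tent_ht_out ?ljk ?orbT.
case: (leqP k (i + j)) => lkm.
  rewrite tent_ht_up ?(ltnW lki) //; have [_] := ht_lipschitz x lkm lm.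
  by clear -h lki lkm; lia.
rewrite tent_ht_down ?(ltnW lkm) ?(ltnW ljk) //.
have [] := ht_lipschitz x (ltnW lkm) lk.
by clear -h ljk lkm; lia.
Qed.

(** By [tent_le] only the apex of the first tent matters. Its height is at least 2, out of reach of
    the zigzag, so both slopes of the second triangle must reach it: one gives i' <= i, the other j
    <= j'. *)
Lemma tent_mono i j i' j' : i + 2 <= j -> j <= n -> j' <= n ->
  (tent i j <= tent i' j')%O = (i' <= i) && (j <= j').
Proof.
move=> lij ljn lj'n; have lm : i + j <= n.*2 by clear -lij ljn; lia.
rewrite tent_le //; last by clear -lij; lia.
rewrite ht_tent // /tent_ht leq_max leq_min.
rewrite (_ : (j - i <= odd _) = false) /=; first by clear -lij; lia.
by apply/negbTE; rewrite -ltnNge; apply: leq_ltn_trans (leq_b1 _) _; clear -lij; lia.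
Qed.

Lemma tent_join_irreducible i j : i + 2 <= j -> j <= n ->
  join_irreducible (tent i j).
Proof.
move=> lij ljn; apply/andP; split.
  apply/eqP => /(congr1 (fun x => ht x (i + j))).
  have lm : i + j <= n.*2 by clear -lij ljn; lia.
  rewrite ht_bot // ht_tent // tent_ht_up; [|clear -lij; lia..] => e.
  by have := leq_b1 (odd (i + j)); rewrite -e; clear -lij; lia.
apply/forallP=> u; apply/forallP=> v; apply/implyP=> /eqP e.
(* At the apex the height of the join is the larger of the two heights, so [u] or [v] already
   reaches it. *)
have /orP[h|h] : (tent i j <= u)%O || (tent i j <= v)%O.
  have := lexx (tent i j); have lij' : i <= j by clear -lij; lia.
  by rewrite {2}e !tent_le // ht_join leq_max.
- by apply/orP; left; apply/eqP/le_anti; rewrite h /= e leUl.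
- by apply/orP; right; apply/eqP/le_anti; rewrite h /= e leUr.
Qed.

End Tent.

(** * Peaks of height at least 2 and join-irreducibility *)

Section Peaks.
Variable n : nat.
Implicit Types x y : dyck n.

(* Peaks at height one are excluded: these are the ones that cannot be
   lowered. *)
Definition peak x (k : nat) : Prop :=
  [/\ 0 < k, k < n.*2, 2 <= ht x k, ht x k.-1 < ht x k & ht x k.+1 < ht x k].

(** Walk left from the descent: either the step before is up, giving a peak, or the path is higher
    still and again descends. The walk stops because the path starts at height 0. *)
Lemma peak_left x k : k < n.*2 -> 2 <= ht x k -> ht x k.+1 < ht x k ->
  exists2 m, peak x m & m <= k.
Proof.
elim: k => [|k IH] lk h2 hd; first by rewrite ht0 in h2.
case: (ltnP (ht x k) (ht x k.+1)) => hk; first by exists k.+1.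
have hs := ht_step x (ltnW lk).
by have [||m pm lm] := IH (ltnW lk); [lia..|exists m => //; lia].
Qed.

Lemma peak_right x k : 0 < k -> k <= n.*2 -> 2 <= ht x k -> ht x k.-1 < ht x k ->
  exists2 m, peak x m & k <= m.
Proof.
move=> k0 lk; move ed: (n.*2 - k) => d.
elim: d k k0 lk ed => [|d IH] k k0 lk ed h2 hu.
  by move: h2; rewrite (_ : k = n.*2) ?ht_end //; lia.
have lk' : k < n.*2 by lia.
case: (ltnP (ht x k.+1) (ht x k)) => hk; first by exists k.
have hs := ht_step x lk'.
have [|||||m pm lm] := IH k.+1; rewrite /=; try lia.
by exists m => //; lia.
Qed.

Lemma exists_peak x k : k <= n.*2 -> 2 <= ht x k -> exists m, peak x m.
Proof.
case: k => [|k] lk h2; first by rewrite ht0 in h2.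
case: (ht_step x lk) => hs.
  by have [|||| m pm _] := @peak_right x k.+1; rewrite /=; try lia; exists m.
by have [||| m pm _] := @peak_left x k; try lia; exists m.
Qed.

Lemma exists_peak_neq_bot x : x != \bot%O -> exists m, peak x m.
Proof.
move=> nb; have [/existsP[k h2]|/existsPn h] :=
  boolP [exists k : 'I_n.*2.+1, 2 <= ht x k].
  exact: exists_peak (leq_ord k) h2.
(* Heights at most 1 are determined by their parity, so the path is the zigzag. *)
case/eqP: nb; apply: ht_inj => k lk; rewrite ht_bot //.
by have /= := h (Ordinal (lk : k < n.*2.+1)); have := ht_odd x lk; lia.
Qed.

(** Both neighbours lie one below the peak, so lowering it by 2 just reverses the two adjacent
    steps; height at least 2 keeps the path nonnegative. *)
Lemma peak_lower x k : peak x k ->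
  exists y : dyck n, forall m, m <= n.*2 ->
    ht y m = if m == k then (ht x k).-2 else ht x m.
Proof.
case=> k0 kn h2 hl hr.
pose f m := if m == k then (ht x k).-2 else ht x m.
suff fP : is_dyck [ffun m : 'I_(n.*2).+1 => f m].
  by exists (Dyck fP) => m lm; rewrite ht_Dyck.
apply/dyckP; split=> [||m lm]; rewrite /f !ffunE !inordK ?ht0 ?ht_end; try lia.
- by case: eqP => //; lia.
- by case: eqP => //; lia.
have hs := ht_step x lm.
case: (eqVneq m k) => [e|n1]; case: (eqVneq m.+1 k) => [e'|n2]; try lia.
  by move: hr hs; rewrite e; lia.
by move: h2 hl hs; rewrite -e' /=; lia.
Qed.

Lemma join_irreducible_peak_inj x k l :
  join_irreducible x -> peak x k -> peak x l -> k = l.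
Proof.
move=> /andP[_ /forallP ji] pk pl.
have [y yP] := peak_lower pk; have [z zP] := peak_lower pl.
have [//|/negbTE nkl] := eqVneq k l.
have neq w m : peak x m ->
    (forall a, a <= n.*2 -> ht w a = if a == m then (ht x m).-2 else ht x a) ->
    (x == w) = false.
  case=> m0 mn m2 _ _ wP; apply/negbTE/eqP => e.
  by have := wP m (ltnW mn); rewrite eqxx -e; lia.
have /= /forallP/(_ z) /= := ji y.
rewrite (neq _ _ pk yP) (neq _ _ pl zP) orbF implybF => /eqP[].
(* At each abscissa at most one of [y] and [z] is lowered, so their join is [x]. *)
apply: ht_inj => a la.
rewrite ht_join yP ?zP //.
case: (eqVneq a k) => [->|_]; first by rewrite nkl; lia.
by case: (eqVneq a l) => [->|_]; lia.
Qed.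

Lemma unique_peak_left x k m : (forall l, peak x l -> l = k) ->
  m < k -> k <= n.*2 -> 2 <= ht x m -> ht x m.+1 = (ht x m).+1.
Proof.
move=> uk lmk lk h2; have lm := leq_trans lmk lk.
case: (ht_step x lm) => // hs.
have hd : ht x m.+1 < ht x m by rewrite hs.
by have [l /uk -> lkm] := peak_left lm h2 hd; lia.
Qed.

Lemma unique_peak_right x k m : (forall l, peak x l -> l = k) ->
  k < m -> m <= n.*2 -> 2 <= ht x m -> ht x m.-1 = (ht x m).+1.
Proof.
case: m => // m uk lkm lm h2.
case: (ht_step x lm) => // hs.
have hu : ht x m < ht x m.+1 by rewrite hs.
by have [l /uk -> lmk] := peak_right (ltn0Sn m) lm h2 hu; lia.
Qed.

Lemma unique_peak_tent x k : peak x k -> (forall l, peak x l -> l = k) ->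
  exists i j, [/\ i + 2 <= j, j <= n & x = tent n i j].
Proof.
move=> [k0 kn h2 hl hr] uk.
have [kx ox] := dyck_bounds x (ltnW kn); have kx' := dyck_bounds_end x (ltnW kn).
rewrite -!/(ht x k) in kx ox kx'.
have [i [j [ek eh lij ljn]]] :
    exists i j, [/\ k = i + j, ht x k = j - i, i + 2 <= j & j <= n].
  (* These solve i + j = k and j - i = [ht x k]. The halves are exact because height and abscissa
     have the same parity; j <= n since the height is at most 2n - k. *)
  exists (k - ht x k)./2, (k + ht x k)./2.
  by split; clear -kx kx' ox h2; lia.
clear kx kx' ox; exists i, j; split=> //.
apply/le_anti/andP; split; last first.
  by rewrite tent_le -?ek -?eh //; clear -lij; lia.
(* To the left of the peak, a height of at least 2 is one less than the height one step closer to
   the peak; [right] is the mirror image. *)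
have left d : d <= k -> ht x (k - d) <= maxn 1 (ht x k - d).
  elim: d => [|d IH] ld; first by rewrite !subn0 leq_maxr.
  case: (leqP 2 (ht x (k - d.+1))) => [hd|]; last by move: IH => _; lia.
  have lt : k - d.+1 < k by lia.
  have := unique_peak_left uk lt (ltnW kn) hd; rewrite subnSK // => e.
  by have := IH (ltnW ld); rewrite e; clear; lia.
have right d : k + d <= n.*2 -> ht x (k + d) <= maxn 1 (ht x k - d).
  elim: d => [|d IH] ld; first by rewrite addn0 subn0 leq_maxr.
  case: (leqP 2 (ht x (k + d.+1))) => [hd|]; last by move: IH => _; lia.
  have lt : k < k + d.+1 by lia.
  have := unique_peak_right uk lt ld hd; rewrite addnS /= => e.
  by have := IH ltac:(lia); rewrite e; clear; lia.
apply/le_htP => m lm; rewrite ht_tent //.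
(* Parity sharpens the bound 1 to the height of the zigzag. *)
have odd_max a h : h <= maxn 1 a -> h <= maxn (odd h) a.
  by case: h => [|[|h]] //; rewrite !leq_max /= => ->; rewrite orbT.
have tent_bound a : a <= m - i.*2 -> a <= j.*2 - m -> ht x m <= maxn 1 a ->
    ht x m <= tent_ht i j m.
  move=> a1 a2 /odd_max/leq_trans; apply; rewrite ht_odd // geq_max leq_maxl.
  by rewrite leq_max leq_min a1 a2 orbT.
case: (leqP m k) => lmk.
  have := left (k - m) (leq_subr _ _); rewrite subKn // eh.
  by apply: tent_bound; clear -ek lmk; lia.
have := right (m - k); rewrite subnKC; last exact: ltnW.
move/(_ lm); rewrite eh.
by apply: tent_bound; clear -ek lmk; lia.
Qed.

Lemma tent_peak i j : i + 2 <= j -> j <= n ->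
  forall l, peak (tent n i j) l <-> l = i + j.
Proof.
move=> lij ljn l; split=> [[l0 ln]|->]; last first.
  split; rewrite ?ht_tent //; try by clear -lij ljn; lia.
  - by rewrite tent_ht_up; clear -lij; lia.
  - by rewrite !tent_ht_up; clear -lij; lia.
  - by rewrite !tent_ht_down; clear -lij; lia.
rewrite !ht_tent //; [|clear -l0 ln; lia..] => h2 hl hr.
(* Outside the triangle heights are at most 1, too low for a peak. *)
have out : ~~ ((l <= i.*2) || (j.*2 <= l)).
  apply/negP => /tent_ht_out e.
  by move: h2; rewrite e; case: odd.
move: out; rewrite negb_or -!ltnNge => /andP[l1 l2].
case: (ltngtP l (i + j)) => // lm.
  by move: hr; rewrite !tent_ht_up; clear -l1 lm; lia.
by move: hl; rewrite !tent_ht_down; clear -l2 lm; lia.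
Qed.

Lemma join_irreducibleP x : join_irreducible x <->
  exists i j, [/\ i + 2 <= j, j <= n & x = tent n i j].
Proof.
split=> [ji|[i [j [lij ljn ->]]]]; last exact: tent_join_irreducible.
have /andP[nb _] := ji; have [k pk] := exists_peak_neq_bot nb.
by apply: (unique_peak_tent pk) => l pl; apply: join_irreducible_peak_inj ji _ _.
Qed.

End Peaks.

(** * Pyramids correspond to peaks through their centres *)

Section Pyramids.
Variable n : nat.
Implicit Types x y : dyck n.

(** The height profile of a factor U^h D^h starting after p steps. *)
Definition run x (p h : nat) : Prop :=
  p + h.*2 <= n.*2 /\
  forall i, i <= h.*2 -> ht x (p + i) = ht x p + minn i (h.*2 - i).

Lemma run_word x (s t : seq bool) h :
  word x = s ++ nseq h U ++ nseq h D ++ t -> run x (size s) h.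
Proof.
move=> e; have sz := congr1 size e.
rewrite size_word !size_cat !size_nseq in sz.
split=> [|i li]; first by clear -sz; lia.
have lsi : size s + i <= n.*2 by clear -sz li; lia.
have := count_take_word x lsi; have := count_take_word x (leq_trans (leq_addr i _) lsi).
rewrite e !count_take_cat !count_take_U !count_take_D !size_nseq subnn !sub0n !take0.
rewrite take_size (@take_oversize _ (size s + i)) ?leq_addr //.
have -> : size s + i - size s - h - h = 0 by clear -li; lia.
by rewrite take0 /= min0n; clear -li; lia.
Qed.

(** A balanced factor [v] put in place of a balanced one of the same length leaves heights outside
    the window unchanged. It serves both for U^h D^h itself and for its replacement. *)
Lemma count_take_splice x p h (v : seq bool) k : p + h.*2 <= n.*2 ->
  ht x (p + h.*2) = ht x p -> size v = h.*2 -> count id v = h -> k <= n.*2 ->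
  (count id (take k (take p (word x) ++ v ++ drop (p + h.*2) (word x)))).*2 =
    if p <= k <= p + h.*2 then ht x p + p + (count id (take (k - p) v)).*2
    else ht x k + k.
Proof.
move=> lp e sv cv lk; have lpn := leq_trans (leq_addr _ p) lp.
have sp : size (take p (word x)) = p by rewrite size_takel ?size_word.
rewrite !count_take_cat sp sv -take_min.
have := count_take_word x lpn; have := count_take_word x lp.
case: (leqP p k) => lpk /=; last first.
  rewrite -(count_take_word x lk).
  by rewrite (_ : k - p = 0) ?sub0n ?take0 //=; clear -lpk; lia.
case: (leqP k (p + h.*2)) => lkq.
  rewrite (_ : k - p - h.*2 = 0) ?take0 /=; last by clear -lkq; lia.
  by clear; lia.
rewrite (@take_oversize _ (k - p)) ?sv ?cv; last by clear -lkq; lia.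
have := count_take_word x lk; have {1}-> : k = p + h.*2 + (k - p - h.*2).
  by clear -lkq; lia.
by rewrite takeD count_cat e; clear; lia.
Qed.

Lemma run_peak x p h : 0 < h -> run x p h -> 2 <= ht x (p + h) -> peak x (p + h).
Proof.
move=> h0 [lp r] h2; have hmid := r h ltac:(clear; lia).
split=> //; try by clear -h0 lp; lia.
  have := r h.-1 ltac:(clear; lia); rewrite hmid.
  by rewrite (_ : p + h.-1 = (p + h).-1); clear -h0; lia.
have := r h.+1 ltac:(clear -h0; lia); rewrite hmid addnS.
by clear -h0; lia.
Qed.

(** The replacement lowers the centre by 2 and changes no other height, so it yields a Dyck path
    precisely when the centre has height at least 2. *)
Lemma replaceableP x p h :
  replaceable x p h <-> [/\ 0 < h, run x p h & 2 <= ht x (p + h)].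
Proof.
have cDU k : count id (take k [:: D; U]) = (1 < k) by case: k => [|[|k]].
split=> [[h0 [s [t [<- e [y ey]]]]]|[h0 [lp r] h2]].
  have rx := run_word e; split=> //.
  have lsh : size s + h <= n.*2 by case: rx; clear; lia.
  (* Up to the centre, [y] has one up step less than [x], so its height there is 2 less. *)
  have := count_take_word x lsh; have := count_take_word y lsh.
  rewrite e ey !count_take_cat !count_take_U !count_take_D !size_nseq.
  rewrite (@take_oversize _ (size s + h)) ?leq_addr // addKn subnn !sub0n take0.
  rewrite cDU (_ : h - h.-1 = 1); last by clear -h0; lia.
  by rewrite take0 /= minnn; clear -h0; lia.
have rp := r _ (leqnn _); rewrite subnn minn0 addn0 in rp.
have hmid := r h ltac:(clear; lia).
have [y yP] := peak_lower (run_peak h0 (conj lp r) h2).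
split=> //; exists (take p (word x)), (drop (p + h.*2) (word x)).
have lpn : p <= n.*2 by clear -lp; lia.
split; first by rewrite size_takel ?size_word.
  rewrite (catA (nseq h U)).
  apply: word_eq => [|k lk].
    by rewrite !size_cat !size_nseq size_takel ?size_drop size_word //; clear -lp; lia.
  rewrite count_take_splice ?size_cat ?size_nseq ?count_cat ?count_nseq //=;
    try by clear; lia.
  case: ifP => // /andP[l1 l2]; rewrite count_take_cat count_take_U count_take_D.
  have := r (k - p) ltac:(clear -l1 l2; lia).
  by rewrite subnKC //; clear -l1 l2; lia.
exists y; rewrite (catA [:: D; U]) (catA (nseq h.-1 U)).
apply: word_eq => [|k lk].
  by rewrite !size_cat !size_nseq size_takel ?size_drop size_word //=; clear -lp h0; lia.
rewrite count_take_splice ?size_cat ?size_nseq ?count_cat ?count_nseq //=;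
  try by clear -h0; lia.
rewrite yP //; case: ifP => [/andP[l1 l2]|nk]; last first.
  by case: eqP => // ek; move: nk; rewrite ek; clear; lia.
rewrite count_take_cat -[D :: U :: _]/([:: D; U] ++ _) count_take_cat.
rewrite count_take_U count_take_D cDU size_nseq.
have := r (k - p) ltac:(clear -l1 l2; lia).
rewrite subnKC //; case: eqP => [->|nk]; first by rewrite addKn; clear -h0 h2; lia.
by clear -l1 l2 h0 nk; lia.
Qed.

Lemma replaceable_peak x p h : replaceable x p h -> peak x (p + h).
Proof. by case/replaceableP; apply: run_peak. Qed.

(* The heights along U^h D^h increase up to its centre and decrease after it,
   so that the centre is the only peak strictly inside. *)
Lemma run_peak_center x p h k : run x p h -> p < k < p + h.*2 -> peak x k ->
  k = p + h.
Proof.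
move=> [lp r] /andP[l1 l2] [_ _ _ hl hr].
have := r (k - p) ltac:(clear -l1 l2; lia).
have := r (k - p).-1 ltac:(clear -l1 l2; lia).
have := r (k - p).+1 ltac:(clear -l1 l2; lia).
rewrite (_ : p + (k - p).-1 = k.-1); last by clear -l1; lia.
rewrite addnS subnKC; last exact: ltnW.
by clear -l1 l2 hl hr; lia.
Qed.

Lemma pyramid_peak x p h : pyramid x p h -> peak x (p + h).
Proof. by case=> /replaceable_peak. Qed.

(** The pyramid is the largest factor U^h D^h centred at k: any replaceable factor containing it has
    k strictly inside, hence is centred at k too. *)
Lemma peak_pyramid x k : peak x k -> exists p h, pyramid x p h /\ p + h = k.
Proof.
move=> pk; have [k0 kn h2 hl hr] := pk.
(* A boolean form of [run] centred at k, so that a maximal h can be extracted; the height condition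
   of [replaceableP] comes from the peak. *)
pose Q h := [&& 0 < h, h <= k, k + h <= n.*2 &
  [forall i : 'I_(h.*2).+1, ht x (k - h + i) == ht x (k - h) + minn i (h.*2 - i)]].
have QP h : reflect (h <= k /\ replaceable x (k - h) h) (Q h).
  apply: (iffP and4P) => [[h0 lh lkh /forallP r]|[lh /replaceableP[h0 [lp r] _]]].
    split=> //; apply/replaceableP; split; rewrite ?subnK //.
    split; first by clear -lh lkh; lia.
    by move=> i li; apply/eqP/(r (Ordinal (li : i < h.*2.+1))).
  split=> //; first by clear -lh lp; lia.
  by apply/forallP => i; apply/eqP/r/leq_ord.
have Q1 : Q 1.
  apply/and4P; split=> //; first by rewrite addn1.
  have e1 : k - 1 = k.-1 by rewrite subn1.
  have hs1 := @ht_step _ x k.-1 ltac:(clear -kn; lia).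
  have hs2 := ht_step x kn.
  rewrite prednK // in hs1.
  apply/forallP=> -[[|[|[|i]]] //= _]; rewrite e1 ?addn0 ?addn1 ?addn2 ?prednK //;
    by clear -hs1 hs2 hl hr; lia.
have Qb h : Q h -> h <= k by case/and4P.
case: (ex_maxnP (ex_intro _ 1 Q1) Qb) => h /QP[lh rh] hmax.
exists (k - h), h; split; last exact: subnK.
split=> // p' h' r' l1 l2.
have /replaceableP[h0 _ _] := rh; have /replaceableP[h0' run' _] := r'.
have ek : k = p' + h'.
  by apply: (run_peak_center run') pk; clear -l1 l2 h0 lh; lia.
have ep : p' = k - h' by rewrite ek addnK.
have lh' : h' <= h by apply/hmax/QP; rewrite -ep ek leq_addl.
by clear -ep ek lh lh' l1; lia.
Qed.

(** Factors with the same centre are nested, so the maximality of the smaller forces equality. *)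
Lemma pyramid_inj x p h p' h' : pyramid x p h -> pyramid x p' h' ->
  p + h = p' + h' -> (p, h) = (p', h').
Proof.
move=> [r m] [r' m'] e; case: (leqP h h') => l.
  by have [| |-> -> //] := m _ _ r'; clear -e l; lia.
by have [| |-> -> //] := m' _ _ r; clear -e l; lia.
Qed.

Lemma one_pyramidP x : has_exactly_one_pyramid x <-> exists! k, peak x k.
Proof.
split=> [[[p h] /= [py u]]|[k [pk u]]].
  exists (p + h); split; first exact: pyramid_peak.
  move=> k /peak_pyramid[p' [h' [py' <-]]].
  by have [-> ->] := u (p', h') py'.
have [p [h [py e]]] := peak_pyramid pk.
exists (p, h); split=> // -[p' h'] /= py'; apply: (pyramid_inj py py').
by rewrite e; apply: u; apply: pyramid_peak.
Qed.

Lemma one_pyramid_tentP x : has_exactly_one_pyramid x <->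
  exists i j, [/\ i + 2 <= j, j <= n & x = tent n i j].
Proof.
rewrite one_pyramidP; split=> [[k [pk u]]|[i [j [lij ljn ->]]]].
  by apply: (unique_peak_tent pk) => l /u ->.
exists (i + j); split; first exact/tent_peak.
by move=> l /(tent_peak lij ljn).
Qed.

End Pyramids.

(** * The spectrum, far pairs and intervals of a chain *)

Section OrderIsomorphisms.

(** Reflecting the order gives injectivity by antisymmetry, and choice in [P] gives an inverse. *)
Lemma order_isomorphic_surj d d' (P : finPOrderType d) (Q : porderType d')
    (f : P -> Q) :
  {mono f : x y / (x <= y)%O} -> (forall y, exists x, f x = y) ->
  order_isomorphic P Q.
Proof.
move=> fm fs; exists f; split=> //.
have fs' y : exists x, f x == y by have [x <-] := fs y; exists x.
have fK y : f (xchoose (fs' y)) = y by apply/eqP/(xchooseP (fs' y)).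
exists (fun y => xchoose (fs' y)) => x //.
by apply: (inc_inj fm); rewrite fK.
Qed.

Lemma order_isomorphic_sym d d' (P : porderType d) (Q : porderType d') :
  order_isomorphic P Q -> order_isomorphic Q P.
Proof.
move=> [f [[g fK gK] fm]]; exists g; split; first by exists f.
by move=> x y; rewrite -fm !gK.
Qed.

Lemma spec_far_pairs n : order_isomorphic (spec (dyck n)) (far_pairs n).
Proof.
apply: order_isomorphic_sym.
have ji (p : far_pairs n) : join_irreducible (tent n (val p).1 (val p).2).
  by apply: tent_join_irreducible; [exact: valP p | exact: leq_ord].
apply: (@order_isomorphic_surj _ _ _ _ (fun p => Spec (ji p))) => [p q|y].
  exact: tent_mono (valP p) (leq_ord _) (leq_ord _).
have /join_irreducibleP[i [j [lij ljn e]]] := valP y.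
have lin : i < n.+1 by clear -lij ljn; lia.
exists (@FarPair n (Ordinal lin, Ordinal (ljn : j < n.+1)) lij).
exact/val_inj.
Qed.

(** The interval [i, j - 2], with the upper bound written without truncated subtraction. *)
Definition far_interval_set n (p : far_pairs n) : {set 'I_n.-1} :=
  [set x : 'I_n.-1 | ((val p).1 <= x) && (x + 2 <= (val p).2)].

Lemma far_interval_subproof n (p : far_pairs n) :
  is_nonempty_interval (far_interval_set p).
Proof.
case: p => -[[i ilt] [j jlt]] /= lij.
have li : i < n.-1 by clear -jlt lij; lia.
have lj : j - 2 < n.-1 by clear -jlt lij; lia.
apply/andP; split.
  apply/set0Pn; exists (Ordinal li); rewrite inE /= leqnn /=.
  exact: lij.
apply/existsP; exists (Ordinal li); apply/existsP; exists (Ordinal lj).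
apply/eqP/setP => x; rewrite !inE /= !leEord /=.
by clear -lij; lia.
Qed.

Lemma far_pairs_intervals n : order_isomorphic (far_pairs n) (intervals 'I_n.-1).
Proof.
apply: (@order_isomorphic_surj _ _ _ _ (fun p => Interval (far_interval_subproof p))).
  move=> [[[i ilt] [j jlt]] /= lij] [[[i' ilt'] [j' jlt']] /= lij'].
  apply/idP/idP => [/subsetP s|/andP[/= l1 l2]]; last first.
    by apply/subsetP=> x; rewrite !inE /=; clear -l1 l2; lia.
  have li : i < n.-1 by clear -jlt lij; lia.
  have lj : j - 2 < n.-1 by clear -jlt lij; lia.
  (* Inclusion of intervals is tested at the two endpoints i and j - 2. *)
  have := s (Ordinal li); have := s (Ordinal lj); rewrite !inE /=.
  by move=> a b; apply/andP => /=; move: a b; clear -lij lij'; lia.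
case=> A /= AP; have /andP[/set0Pn[x xA] /existsP[a /existsP[b /eqP eA]]] := AP.
(* Nonemptiness gives a <= b, so (a, b + 2) is a far pair; it is the preimage of [a, b]. *)
have lab : a <= b.
  by move: xA; rewrite eA inE !leEord => /andP[]; apply: leq_trans.
have ha := ltn_ord a; have hb := ltn_ord b.
have la : a < n.+1 by clear -ha; lia.
have lb : b + 2 < n.+1 by clear -hb; lia.
have lab2 : a + 2 <= b + 2 by rewrite leq_add2r.
exists (@FarPair n (Ordinal la, Ordinal lb) lab2).
by apply/val_inj/setP => y; rewrite /= eA !inE /= !leEord leq_add2r.
Qed.

End OrderIsomorphisms.

Theorem proposition3p7 (n : nat) (hn : 1 <= n) :
  [/\
      forall x : dyck n, join_irreducible x <-> has_exactly_one_pyramid x,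
      (forall x : dyck n, has_exactly_one_pyramid x <->
         exists i j : nat,
           [/\ i + 2 <= j, j <= n &
               word x = UD_pow i ++ nseq (j - i) U ++ nseq (j - i) D
                        ++ UD_pow (n - j)])
      /\ (forall i j : nat, i + 2 <= j -> j <= n ->
            exists x : dyck n,
              word x = UD_pow i ++ nseq (j - i) U ++ nseq (j - i) D
                       ++ UD_pow (n - j)),
      order_isomorphic (spec (dyck n)) (far_pairs n) &
      order_isomorphic (far_pairs n) (intervals 'I_n.-1)].
Proof.
have le2 i j : i + 2 <= j -> i <= j by apply: leq_trans; apply: leq_addr.
split; [|split| exact: spec_far_pairs | exact: far_pairs_intervals].
- by move=> x; rewrite join_irreducibleP one_pyramid_tentP.
- move=> x; rewrite one_pyramid_tentP.
  split=> -[i [j [lij ljn e]]]; exists i, j; split=> //.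
    by rewrite e word_tent // le2.
  by apply: word_inj; rewrite e word_tent // le2.
- by move=> i j lij ljn; exists (tent n i j); rewrite word_tent // le2.
Qed.
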